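(* Let $(E,\mathcal F)$ be an upper interval greedoid (antimatroid), and let $\mathcal L$ be the set of all covectors of $(E,\mathcal F)$. Then $(E,\mathcal F,\mathcal L)$ is an oriented interval greedoid.
   Context: An upper interval greedoid (antimatroid) is a finite set $E$ and a nonempty family $\mathcal F$ of subsets satisfying: (IG1) every nonempty $X\in\mathcal F$ has $x\in X$ with $X\setminus\{x\}\in\mathcal F$; (IG2) if $X,Y\in\mathcal F$, $|X|>|Y|$, there is $x\in X\setminus Y$ with $Y\cup\{x\}\in\mathcal F$; (UIP) if $X\subseteq Y$ in $\mathcal F$, $e\in E\setminus Y$ and $X\cup\{e\}\in\mathcal F$, then $Y\cup\{e\}\in\mathcal F$. Such a pair is an interval greedoid, i.e. also satisfies (IG3): if $X\subseteq Y\subseteq Z$ in $\mathcal F$, $e\notin Z$, $X\cup\{e\},Z\cup\{e\}\in\mathcal F$, then $Y\cup\{e\}\in\mathcal F$. For an interval greedoid: $\Gamma(X)=\{x\in E\setminus X:X\cup\{x\}\in\mathcal F\}$; $X\sim Y$ iff $\Gamma(X)=\Gamma(Y)$; classes $[X]$ are flats; $\Phi$ the set of flats ordered by $[X]\le[Y]$ iff there is $Z\subseteq E\setminus Y$ with $Y\cup Z\in\mathcal F$ and $Y\cup Z\sim X$ (a lattice). For a flat $A=[X]$: $\Gamma(A)=\Gamma(X)$, $\xi(A)=\bigcup_{X'\sim X}X'$. $\mu(S)=[X]$ for $X$ inclusion-maximal feasible in $S\subseteq E$; join $A\vee B=\mu(\xi(A)\cap\xi(B))$. A covector is $\alpha:E\to\{0,+,-,1\}$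 such that for some flat $A=\mathrm{supp}(\alpha)$, $\alpha\in\{+,-\}$ on $\Gamma(A)$, $0$ on $\xi(A)$, $1$ elsewhere. Symbols ordered $0<+<1$, $0<-<1$. Product: with $C=\mathrm{supp}\,\alpha\vee\mathrm{supp}\,\beta$, $(\alpha\circ\beta)(e)=\beta(e)$ if $e\in\Gamma(C)\cup\xi(C)$ and $\beta(e)>\alpha(e)$; $\alpha(e)$ if $e\in\Gamma(C)\cup\xi(C)$ otherwise; $1$ otherwise. $-\alpha$ swaps $+,-$; $S(\alpha,\beta)=\{e:\alpha(e)=-\beta(e)\in\{+,-\}\}$. Oriented interval greedoid: $(E,\mathcal F,\mathcal L)$, $\mathcal L$ a set of covectors with (OG1) $\mathrm{supp}:\mathcal L\to\Phi$ surjective; (OG2) $-\mathcal L=\mathcal L$; (OG3) closed under $\circ$; (OG4) if $\alpha,\beta\in\mathcal L$, $x\in S(\alpha,\beta)$, $(\alpha\circ\beta)(x)\ne1$, some $\gamma\in\mathcal L$ has $\gamma(x)=0$ and $\gamma(y)=(\alpha\circ\beta)(y)=(\beta\circ\alpha)(y)$ for all $y\notin S(\alpha,\beta)$ with $(\alpha\circ\beta)(y)\neq1$. *)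

(* Defs.v *)
From HB Require Import structures.
From mathcomp Require Import all_boot.

Set Implicit Arguments.
Unset Strict Implicit.
Unset Printing Implicit Defensive.

Section Greedoids.
Variables (E : finType) (F : {set {set E}}).

Record interval_greedoid : Prop := IntervalGreedoid {
  ig_nonempty : F != set0;
  ig1 : forall X, X \in F -> X != set0 ->
    exists2 x, x \in X & X :\ x \in F;
  ig2 : forall X Y, X \in F -> Y \in F -> #|Y| < #|X| ->
    exists2 x, x \in X :\: Y & x |: Y \in F;
  ig3 : forall X Y Z e, X \in F -> Y \in F -> Z \in F ->
    X \subset Y -> Y \subset Z -> e \notin Z ->
    e |: X \in F -> e |: Z \in F -> e |: Y \in F
}.

Record upper_interval_greedoid : Prop := UpperIntervalGreedoid {
  uig_nonempty : F != set0;
  uig1 : forall X, X \in F -> X != set0 ->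
    exists2 x, x \in X & X :\ x \in F;
  uig2 : forall X Y, X \in F -> Y \in F -> #|Y| < #|X| ->
    exists2 x, x \in X :\: Y & x |: Y \in F;
  uip : forall X Y e, X \in F -> Y \in F -> X \subset Y -> e \notin Y ->
    e |: X \in F -> e |: Y \in F
}.

Definition Gamma (X : {set E}) : {set E} :=
  [set x | (x \notin X) && (x |: X \in F)].

(* The class [X]; a flat is literally a set of feasible sets. *)
Definition flat_class (X : {set E}) : {set {set E}} :=
  [set Y in F | Gamma Y == Gamma X].

Definition flats : {set {set {set E}}} := [set flat_class X | X in F].

(* All members of a flat have the same Gamma, so the union is that common
   value: see flat_GammaE. *)
Definition flat_Gamma (A : {set {set E}}) : {set E} := \bigcup_(X in A) Gamma X.

Definition xi (A : {set {set E}}) : {set E} := \bigcup_(X in A) X.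

(* The class does not depend on which inclusion-maximal feasible subset of S
   is picked: see muE. *)
Definition mu (S : {set E}) : {set {set E}} :=
  flat_class
    (odflt set0 [pick X | maxset (fun Y => (Y \in F) && (Y \subset S)) X]).

Definition flat_join (A B : {set {set E}}) : {set {set E}} :=
  mu (xi A :&: xi B).

Lemma mem_flat_class X : X \in F -> X \in flat_class X.
Proof. by move=> XF; rewrite inE XF eqxx. Qed.

Lemma flat_GammaE X : X \in F -> flat_Gamma (flat_class X) = Gamma X.
Proof.
move=> XF; apply/setP=> e; apply/bigcupP/idP => [[Y]|eX].
  by rewrite inE => /andP[_ /eqP->].
by exists X => //; apply: mem_flat_class.
Qed.

Lemma muE (S X : {set E}) : interval_greedoid ->
  maxset (fun Y => (Y \in F) && (Y \subset S)) X -> mu S = flat_class X.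
Proof.
move=> IG maxX; rewrite /mu; case: pickP => [Y maxY|/(_ X)]; last by rewrite maxX.
suff GG U V : maxset (fun Y => (Y \in F) && (Y \subset S)) U ->
    maxset (fun Y => (Y \in F) && (Y \subset S)) V -> Gamma U \subset Gamma V.
  have GE : Gamma Y = Gamma X by apply/eqP; rewrite eqEsubset !GG.
  by apply/setP => Z; rewrite !inE GE.
have ext W Z e : maxset (fun Y => (Y \in F) && (Y \subset S)) W ->
    Z = e |: W -> Z \in F -> e \in S -> e \in W.
  move=> /maxsetP[/andP[WF WS] Wmax] -> eWF eS.
  rewrite -(Wmax (e |: W)) ?setU11 ?subsetUr //.
  by rewrite eWF subUset sub1set eS WS.
have card W Z : maxset (fun Y => (Y \in F) && (Y \subset S)) W ->
    Z \in F -> Z \subset S -> #|Z| <= #|W|.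
  move=> maxW ZF ZS; rewrite leqNgt; apply/negP=> lt.
  have /maxsetP[/andP[WF WS] _] := maxW.
  have [x /setDP[xZ xW] xWF] := ig2 IG ZF WF lt.
  by move: xW; rewrite (ext _ _ x maxW erefl) // (subsetP ZS).
move=> maxU maxV; apply/subsetP=> e; rewrite !inE => /andP[eU eUF].
have /maxsetP[/andP[UF US] _] := maxU; have /maxsetP[/andP[VF VS] _] := maxV.
have lt : #|V| < #|e |: U| by rewrite cardsU1 eU ltnS card.
have [x /setDP[] xeU xV xVF] := ig2 IG eUF VF lt.
case/setU1P: xeU => [<-|xU]; first by rewrite xV.
by move: xV; rewrite (ext _ _ x maxV erefl) // (subsetP US).
Qed.

End Greedoids.

Inductive csign : predArgType := Zero | Plus | Minus | One.

Definition csign_code (s : csign) : bool * bool :=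
  match s with
  | Zero => (false, false) | Plus => (false, true)
  | Minus => (true, false) | One => (true, true)
  end.
Definition csign_decode (p : bool * bool) : csign :=
  match p with
  | (false, false) => Zero | (false, true) => Plus
  | (true, false) => Minus | (true, true) => One
  end.
Lemma csign_codeK : cancel csign_code csign_decode.
Proof. by case. Qed.

HB.instance Definition _ := Finite.copy csign (can_type csign_codeK).

(* The strict order 0 < + < 1, 0 < - < 1, with + and - incomparable. *)
Definition csign_lt (s t : csign) : bool :=
  match s, t with
  | Zero, (Plus | Minus | One) | (Plus | Minus), One => true
  | _, _ => false
  end.

Definition csign_opp (s : csign) : csign :=
  match s with Plus => Minus | Minus => Plus | s => s end.

Section Covectors.
Variables (E : finType) (F : {set {set E}}).
Implicit Types (A : {set {set E}}) (a b c : {ffun E -> csign}).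

Definition supported_on A a : bool :=
  [&& [forall e in flat_Gamma F A, (a e == Plus) || (a e == Minus)],
      [forall e in xi A, a e == Zero]
    & [forall e, (e \notin flat_Gamma F A :|: xi A) ==> (a e == One)]].

Definition covector a : bool := [exists A in flats F, supported_on A a].

Definition covectors : {set {ffun E -> csign}} := [set a | covector a].

(* Meaningful on covectors, whose supporting flat is unique: see suppE. *)
Definition supp a : {set {set E}} :=
  odflt set0 [pick A in flats F | supported_on A a].

Definition cov_prod a b : {ffun E -> csign} :=
  let C := flat_join F (supp a) (supp b) in
  [ffun e => if e \in flat_Gamma F C :|: xi C then
               if csign_lt (a e) (b e) then b e else a e
             else One].

Definition cov_opp a : {ffun E -> csign} := [ffun e => csign_opp (a e)].

Definition sep a b : {set E} :=
  [set e | ((a e == Plus) || (a e == Minus)) && (a e == csign_opp (b e))].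

Record oriented_interval_greedoid (L : {set {ffun E -> csign}}) : Prop :=
  OrientedIntervalGreedoid {
  oig_greedoid : interval_greedoid F;
  oig_covector : {in L, forall a, covector a};
  og1 : [set supp a | a in L] = flats F;
  og2 : [set cov_opp a | a in L] = L;
  og3 : {in L &, forall a b, cov_prod a b \in L};
  og4 : {in L &, forall a b x, x \in sep a b -> cov_prod a b x != One ->
    exists c, [/\ c \in L, c x = Zero &
      forall y, y \notin sep a b -> cov_prod a b y != One ->
        c y = cov_prod a b y /\ cov_prod a b y = cov_prod b a y]}
}.

Lemma suppE A a : A \in flats F -> supported_on A a -> supp a = A.
Proof.
have sub X Y : X \in F -> Y \in F -> supported_on (flat_class F X) a ->
    supported_on (flat_class F Y) a -> Gamma F X \subset Gamma F Y.
  move=> XF YF /and3P[/forall_inP pmX _ _] /and3P[_ /forall_inP zY /forallP oY].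
  apply/subsetP=> e eX.
  have := pmX e; rewrite flat_GammaE // => /(_ eX).
  have := oY e; rewrite in_setU flat_GammaE //.
  have [//|_ /=] := boolP (e \in Gamma F Y).
  by have [/zY/eqP->|_ /eqP->] := boolP (e \in xi _).
move=> /imsetP[X XF ->{A}] sX; rewrite /supp; case: pickP => [B|].
  case/andP=> /imsetP[Y YF ->{B}] sY /=; apply/setP=> Z; rewrite !inE.
  suff -> : Gamma F Y = Gamma F X by [].
  by apply/eqP; rewrite eqEsubset !sub.
by move/(_ (flat_class F X)); rewrite imset_f // sX.
Qed.

End Covectors.

(* Main.v *)
Require Import Defs.
From mathcomp Require Import all_boot.

(** In an antimatroid a feasible set [X] is determined by [Gamma X], so flats
    are singletons, a covector is an arbitrary choice of signs on [Gamma X], and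
    the join of [X] and [Y] is the largest feasible [Z] inside [X :&: Y].  The
    upper interval property gives [Gamma Z \subset X :|: Gamma X], and likewise
    for [Y], while maximality of [Z] keeps [Gamma Z] off [X :&: Y]; hence a
    product of covectors is again a covector, supported on [Z].  To eliminate
    [x] in (OG4), enlarge [Z] to [x |: Z]: by the upper interval property the
    rest of [Gamma Z] survives in [Gamma (x |: Z)], where any signs may be
    prescribed. *)

Set Implicit Arguments.
Unset Strict Implicit.
Unset Printing Implicit Defensive.

Section Antimatroid.
Variables (E : finType) (F : {set {set E}}).
Hypothesis hF : upper_interval_greedoid F.
Implicit Types (X Y Z S : {set E}) (a b : {ffun E -> csign}).

Lemma upper_interval_greedoidW : interval_greedoid F.
Proof.
case: hF => F0 F1 F2 FU; split=> // X Y Z e XF YF ZF sXY sYZ eZ eXF _.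
by apply: (FU X) => //; apply: contra eZ; apply: (subsetP sYZ).
Qed.

(** Elements are peeled off some feasible set by (IG1). This is what gives every [S] a maximal
    feasible subset. *)
Lemma feasible_set0 : set0 \in F.
Proof.
have /set0Pn[X0] := uig_nonempty hF.
have [n] := ubnP #|X0|; elim: n X0 => // n IHn X leXn XF.
have [<- //|X0] := eqVneq X set0.
have [x xX XxF] := uig1 hF XF X0.
by apply: IHn XxF; move: leXn; rewrite (cardsD1 x) xX.
Qed.

(** The predicate inside [mu], in the form that [muE] expects. *)
Definition max_feasible S Z := maxset (fun Y => (Y \in F) && (Y \subset S)) Z.

Lemma max_feasible_exists S : exists Z, max_feasible S Z.
Proof.
have [|Z maxZ _] := @maxset_exists _ (fun Y => (Y \in F) && (Y \subset S)) set0.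
  by rewrite feasible_set0 sub0set.
by exists Z.
Qed.

Lemma max_feasible_Gamma S Z e :
  max_feasible S Z -> e \in Gamma F Z -> e \notin S.
Proof.
move=> /maxsetP[/andP[_ ZS] Zmax]; rewrite inE => /andP[eZ eZF].
apply: contra eZ => eS; rewrite -(Zmax (e |: Z)) ?setU11 ?subsetUr //.
by rewrite eZF subUset sub1set eS ZS.
Qed.

Lemma Gamma_sub X Y : X \in F -> Y \in F -> X \subset Y ->
  Gamma F X \subset Y :|: Gamma F Y.
Proof.
move=> XF YF sXY; apply/subsetP=> e; rewrite !inE => /andP[_ eXF].
by have [//|eY] := boolP (e \in Y); apply: (uip hF XF).
Qed.

(** If [Z], maximal feasible in [X :&: Y], were smaller than [Y], exchange would give [y] in
    [Y :\: Z] and [Gamma F Z]. Maximality puts [y] outside [X], so [Gamma_sub] puts it in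
    [Gamma F X = Gamma F Y], which is disjoint from [Y]. *)
Lemma Gamma_eq_sub X Y : X \in F -> Y \in F -> Gamma F X = Gamma F Y ->
  Y \subset X.
Proof.
move=> XF YF eqG; have [Z maxZ] := max_feasible_exists (X :&: Y).
have /maxsetP[/andP[ZF]] := maxZ; rewrite subsetI => /andP[ZX ZY] _.
suff /eqP <- : Z == Y by [].
rewrite eqEcard ZY leqNgt; apply/negP => /(uig2 hF YF ZF)[y /setDP[yY yZ] yZF].
have yG : y \in Gamma F Z by rewrite inE yZ.
have := max_feasible_Gamma maxZ yG; rewrite inE yY andbT => yX.
have := subsetP (Gamma_sub ZF XF ZX) y yG.
by rewrite inE (negPf yX) eqG inE yY.
Qed.

Lemma Gamma_inj : {in F &, injective (Gamma F)}.
Proof.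
by move=> X Y XF YF eqG; apply/eqP; rewrite eqEsubset !Gamma_eq_sub.
Qed.

Lemma flat_class1 X : X \in F -> flat_class F X = [set X].
Proof.
move=> XF; apply/setP=> Y; rewrite !inE.
apply/andP/eqP=> [[YF /eqP/Gamma_inj] | -> //]; exact.
Qed.

Lemma xi_flat_class X : X \in F -> xi (flat_class F X) = X.
Proof. by move=> XF; rewrite /xi flat_class1 // big_set1. Qed.

(** Only the places of [Zero] and [One] are constrained: the rest is [Gamma F X], where either sign
    is allowed. *)
Definition covector_at X a : Prop := forall e,
  (a e == Zero) = (e \in X) /\ (a e == One) = (e \notin X :|: Gamma F X).

Lemma supported_onP X a : X \in F ->
  reflect (covector_at X a) (supported_on F (flat_class F X) a).
Proof.
move=> XF; rewrite /supported_on flat_GammaE // xi_flat_class //.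
apply: (iffP and3P) => [[/forall_inP pm /forall_inP z /forallP o] e | aX].
  move: (pm e) (z e) (o e); rewrite !inE.
  case: (e \in X) => /= [_ /(_ isT)/eqP-> //|].
  case: (e |: X \in F) => /= [/(_ isT)/orP[]/eqP-> //|_ _ /eqP-> //].
split; first 1 last.
- by apply/forall_inP=> e eX; rewrite (aX e).1.
- apply/forallP=> e; apply/implyP=> eX.
  by rewrite (aX e).2 setUC.
apply/forall_inP=> e eG; have [] := aX e; rewrite in_setU eG orbT.
by move: eG; rewrite inE => /andP[/negPf-> _]; case: (a e).
Qed.

Lemma covectorsP a :
  reflect (exists2 X, X \in F & covector_at X a) (a \in covectors F).
Proof.
rewrite inE; apply: (iffP exists_inP) => [[_ /imsetP[X XF ->]]|[X XF]].
  by move/(supported_onP _ XF); exists X.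
by move/(supported_onP _ XF); exists (flat_class F X); rewrite ?imset_f.
Qed.

Lemma supp_covector_at X a : X \in F -> covector_at X a ->
  supp F a = flat_class F X.
Proof.
by move=> XF aX; apply: suppE; [apply: imset_f | apply/supported_onP].
Qed.

(** Any value of [s] but [Minus] is read as [Plus], so that every [s] yields a covector. *)
Definition covector_with X (s : E -> csign) : {ffun E -> csign} :=
  [ffun e => if e \in X then Zero else if e \notin Gamma F X then One
             else if s e == Minus then Minus else Plus].

Lemma covector_withP X s : covector_at X (covector_with X s).
Proof.
move=> e; rewrite ffunE in_setU.
by case: (e \in X) => //=; case: (e \in Gamma F X) => //=; case: (s e).
Qed.

Lemma covector_at_opp X a : covector_at X a -> covector_at X (cov_opp a).
Proof. by move=> aX e; have := aX e; rewrite ffunE; case: (a e). Qed.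

Lemma cov_oppK : involutive (@cov_opp E).
Proof. by move=> a; apply/ffunP=> e; rewrite !ffunE; case: (a e). Qed.

Section Product.
Variables (X Y Z : {set E}) (a b : {ffun E -> csign}).
Hypotheses (XF : X \in F) (YF : Y \in F) (maxZ : max_feasible (X :&: Y) Z).
Hypotheses (aX : covector_at X a) (bY : covector_at Y b).

Lemma cov_prodE e : cov_prod F a b e =
  if e \in Z :|: Gamma F Z then if csign_lt (a e) (b e) then b e else a e
  else One.
Proof.
have /maxsetP[/andP[ZF _] _] := maxZ.
rewrite ffunE (supp_covector_at XF aX) (supp_covector_at YF bY) /flat_join.
rewrite (xi_flat_class XF) (xi_flat_class YF) (muE upper_interval_greedoidW maxZ).
by rewrite xi_flat_class // flat_GammaE // setUC.
Qed.

(** On [Z] both factors vanish. On [Gamma F Z] neither is [One], by [Gamma_sub], and they are not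
    both [Zero], by maximality of [Z]; so the product is a sign there. *)
Lemma cov_prod_at : covector_at Z (cov_prod F a b).
Proof.
have /maxsetP[/andP[ZF]] := maxZ; rewrite subsetI => /andP[ZX ZY] _ e.
have [aX0 aX1] := aX e; have [bY0 bY1] := bY e; rewrite cov_prodE in_setU.
have [eZ|eZ] := boolP (e \in Z) => /=.
  move: aX0 bY0; rewrite (subsetP ZX) // (subsetP ZY) //.
  by move=> /eqP-> /eqP->.
have [eG|//] := boolP (e \in Gamma F Z).
have := max_feasible_Gamma maxZ eG; rewrite inE -aX0 -bY0.
move: aX1; rewrite (subsetP (Gamma_sub ZF XF ZX)) //.
move: bY1; rewrite (subsetP (Gamma_sub ZF YF ZY)) //.
by case: (a e); case: (b e).
Qed.

End Product.

Lemma cov_prod_covector : {in covectors F &, forall a b,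
  cov_prod F a b \in covectors F}.
Proof.
move=> a b /covectorsP[X XF aX] /covectorsP[Y YF bY]; apply/covectorsP.
have [Z maxZ] := max_feasible_exists (X :&: Y).
have /maxsetP[/andP[ZF _] _] := maxZ.
by exists Z => //; apply: (cov_prod_at XF YF).
Qed.

(** The same [Z] serves both orders, and two symbols fail to commute only when they are opposite
    signs. *)
Lemma cov_prodC_nsep a b y : a \in covectors F -> b \in covectors F ->
  y \notin sep a b -> cov_prod F a b y = cov_prod F b a y.
Proof.
move=> /covectorsP[X XF aX] /covectorsP[Y YF bY].
have [Z maxZ] := max_feasible_exists (X :&: Y).
have maxZ' : max_feasible (Y :&: X) Z by rewrite setIC.
rewrite (cov_prodE XF YF maxZ aX bY) (cov_prodE YF XF maxZ' bY aX).
by rewrite inE; case: (a y); case: (b y).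
Qed.

(** Stronger than (OG4): agreement is also obtained on the rest of [sep a b]. *)
Lemma cov_elimination a b x : a \in covectors F -> b \in covectors F ->
    x \in sep a b -> cov_prod F a b x != One ->
  exists c, [/\ c \in covectors F, c x = Zero &
    forall y, y != x -> cov_prod F a b y != One -> c y = cov_prod F a b y].
Proof.
move=> /covectorsP[X XF aX] /covectorsP[Y YF bY] xS.
have [Z maxZ] := max_feasible_exists (X :&: Y).
have /maxsetP[/andP[ZF _] _] := maxZ.
have pZ := cov_prod_at XF YF maxZ aX bY.
rewrite (pZ x).2 negbK => xZG.
(* Opposite signs at [x] make the product nonzero there, which excludes [x] from [Z]. *)
have xG : x \in Gamma F Z.
  move: xZG; rewrite in_setU -(pZ x).1 (cov_prodE XF YF maxZ aX bY).
  rewrite in_setU; case: (x \in Gamma F Z); rewrite ?orbT //= !orbF.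
  by case: ifP => // _; move: xS; rewrite inE; case: (a x); case: (b x).
have xZF : x |: Z \in F by move: xG; rewrite inE => /andP[].
exists (covector_with (x |: Z) (cov_prod F a b)); split.
- by apply/covectorsP; exists (x |: Z) => //; apply: covector_withP.
- by rewrite ffunE setU11.
move=> y yx py1; have [py0 _] := pZ y; rewrite ffunE in_setU1 (negPf yx) /= -py0.
have [/eqP-> //|pyN0] := boolP (_ == Zero).
have yG : y \in Gamma F Z.
  by move: py1; rewrite (pZ y).2 negbK in_setU -py0 (negPf pyN0).
have := subsetP (Gamma_sub ZF xZF (subsetUr _ _)) y yG.
rewrite in_setU in_setU1 (negPf yx) -py0 (negPf pyN0) /= => ->.
by move: py1 pyN0; case: (cov_prod F a b y).
Qed.

End Antimatroid.

Theorem mainTheorem6 (E : finType) (F : {set {set E}})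
  (hF : upper_interval_greedoid F) :
  oriented_interval_greedoid F (covectors F).
Proof.
have opp_cov a : a \in covectors F -> cov_opp a \in covectors F.
  case/(covectorsP hF) => X XF aX; apply/(covectorsP hF).
  by exists X => //; apply: covector_at_opp.
split.
- exact: upper_interval_greedoidW.
- by move=> a; rewrite inE.
- apply/setP=> A; apply/imsetP/imsetP=> [[a /(covectorsP hF)[X XF aX] ->]|].
    by exists X => //; apply: supp_covector_at.
  (* Any choice of signs would do here. *)
  case=> X XF ->; pose a := covector_with F X (fun=> Plus).
  have aX : covector_at F X a by apply: covector_withP.
  exists a; last by rewrite (supp_covector_at hF XF aX).
  by apply/(covectorsP hF); exists X.
- apply/setP=> a; apply/imsetP/idP=> [[b bL ->]|aL]; first exact: opp_cov.
  by exists (cov_opp a); rewrite ?cov_oppK ?opp_cov.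
- exact: cov_prod_covector.
move=> a b aL bL x xS px1.
have [c [cL cx0 cE]] := cov_elimination hF aL bL xS px1.
exists c; split=> // y yS py1; split; last exact: cov_prodC_nsep.
by apply: cE => //; apply: contraNneq yS => ->.
Qed.
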